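(* Let $(C,\rho)$ be a complete CAT(0) space with the N-property. Let $T\colon C\to C$ be a nonexpansive mapping with $\mathrm{Fix}\,T\neq\emptyset$ and let $f\colon C\to C$ be a $k$-contraction with $k<\frac12$. Then there is a unique fixed point $q\in\mathrm{Fix}\,T$ for which $$P_{\mathrm{Fix}\,T}(f(q))=q.$$ Moreover, for each point $u\in C$ and for each pair of real sequences $(b_n)_{n\ge1}$, $(t_n)_{n\ge1}$ satisfying (i) $b_n,t_n\in(0,1)$ for all $n\in\mathbb{N}$; (ii) $0<\liminf_{n\to\infty} b_n\le\limsup_{n\to\infty} b_n<1$; (iii) $\lim_{n\to\infty}t_n=0$; (iv) $\sum_{n=1}^\infty t_n=\infty$, the sequence $(x_n)$ defined by $$x_1=u,\qquad y_n=t_nf(x_n)+(1-t_n)T(x_n),\qquad x_{n+1}=b_nx_n+(1-b_n)y_n\quad(n\ge1)$$ converges to $q$.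
   Context: A CAT(0) space is a geodesic metric space $(X,\rho)$ in which every geodesic triangle satisfies $\rho(y_1,y_2)\le d(\bar y_1,\bar y_2)$ for all points $y_1,y_2$ on it and their comparison points $\bar y_1,\bar y_2$ on the comparison triangle in the Euclidean plane (with Euclidean distance $d$). Any two points are joined by a unique geodesic segment $[x,y]$; for $\alpha\in(0,1)$, $\alpha x+(1-\alpha)y$ denotes the point $z$ of $[x,y]$ with $\rho(x,z)=(1-\alpha)\rho(x,y)$ and $\rho(z,y)=\alpha\rho(x,y)$. A set $S$ is convex if $[x,y]\subset S$ for all $x,y\in S$. For a nonempty closed convex subset $S$ of a complete CAT(0) space and a point $x$, $P_S(x)$ denotes the (unique) point of $S$ nearest to $x$. N-property: a CAT(0) space $X$ has the N-property if for every (nonempty) closed convex set $S\subset X$ and all $x_1,x_2\in X$ with $P_S(x_1)=P_S(x_2)=P$, one has $P_S(\alpha x_1+(1-\alpha)x_2)=P$ for every $\alpha\in(0,1)$. $T$ is nonexpansive if $\rho(Tx,Ty)\le\rho(x,y)$ for all $x,y$; $\mathrm{Fix}\,T=\{x: Tx=x\}$. $f$ is a $k$-contraction (with $0\le k<1$) if $\rho(f(x),f(y))\le k\rho(x,y)$ for all $x,y$. *)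

(* Defs.v *)
From HB Require Import structures.
From mathcomp Require Import all_boot all_order all_algebra.
From mathcomp Require Import all_classical all_reals all_analysis.

Set Implicit Arguments.
Unset Strict Implicit.
Unset Printing Implicit Defensive.

Import Order.TTheory GRing.Theory Num.Theory.
Import numFieldNormedType.Exports.

Local Open Scope classical_set_scope.
Local Open Scope ring_scope.

#[short(type="completeMetricType")]
HB.structure Definition CompleteMetric (K : numDomainType) :=
  { T of Metric K T & Complete T }.

(* [R * R] carries the sup distance in the library, hence the explicit
   Euclidean one. *)
Definition edist (R : realType) (p q : R * R) : R :=
  Num.sqrt ((p.1 - q.1) ^+ 2 + (p.2 - q.2) ^+ 2).

Section Geodesics.
Context {R : realType} {X : metricType R}.
Implicit Types (x y z : X) (c : R -> X) (S : set X).

(* Only the values of [c] on [0, mdist x y] matter. *)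
Definition is_geodesic x y c : Prop :=
  [/\ c 0 = x, c (mdist x y) = y &
      {in `[0, mdist x y] &, forall s t, mdist (c s) (c t) = `|s - t|}].

Definition geodesic_image x y c : set X := c @` `[0, mdist x y].

(* The union of all geodesic segments from x to y; in a CAT(0) space there is
   exactly one of them. *)
Definition segment x y : set X :=
  [set z | exists2 c, is_geodesic x y c & geodesic_image x y c z].

(* The triangle has vertices v 0, v 1, v 2 and its i-th side c i goes from v i
   to v (i + 1), indices being taken modulo 3. *)
Definition is_geodesic_triangle (v : 'I_3 -> X) (c : 'I_3 -> R -> X) : Prop :=
  forall i, is_geodesic (v i) (v (ordS i)) (c i).

Definition is_comparison_triangle (v : 'I_3 -> X) (w : 'I_3 -> R * R) : Prop :=
  forall i, edist (w i) (w (ordS i)) = mdist (v i) (v (ordS i)).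

(* For y on a geodesic segment from x1 to x2 and a comparison segment from p1
   to p2, of the same length, the two equations force p to lie on it. *)
Definition is_comparison_point x1 x2 (p1 p2 : R * R) y (p : R * R) : Prop :=
  edist p1 p = mdist x1 y /\ edist p p2 = mdist y x2.

(* The default value x is never used in a CAT(0) space. *)
Definition geodesic_comb (a : R) x y : X :=
  xget x [set z | [/\ segment x y z, mdist x z = (1 - a) * mdist x y
                    & mdist z y = a * mdist x y]].

Definition geodesically_convex S : Prop :=
  forall x y, S x -> S y -> segment x y `<=` S.

(* The default value x is never used when S is a nonempty closed convex subset
   of a complete CAT(0) space. *)
Definition metric_proj S x : X :=
  xget x [set p | S p /\ forall s, S s -> mdist x p <= mdist x s].

Definition nonexpansive (T : X -> X) : Prop :=
  forall x y, mdist (T x) (T y) <= mdist x y.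

Definition is_kcontraction (k : R) (f : X -> X) : Prop :=
  0 <= k < 1 /\ forall x y, mdist (f x) (f y) <= k * mdist x y.

Definition Fix (T : X -> X) : set X := [set x | T x = x].

End Geodesics.

Definition geodesic_space (R : realType) (X : metricType R) : Prop :=
  forall x y : X, exists c, is_geodesic x y c.

Definition CAT0 (R : realType) (X : metricType R) : Prop :=
  geodesic_space X /\
  forall (v : 'I_3 -> X) (c : 'I_3 -> R -> X) (w : 'I_3 -> R * R),
    is_geodesic_triangle v c -> is_comparison_triangle v w ->
    forall (i j : 'I_3) (y1 y2 : X) (p1 p2 : R * R),
      geodesic_image (v i) (v (ordS i)) (c i) y1 ->
      geodesic_image (v j) (v (ordS j)) (c j) y2 ->
      is_comparison_point (v i) (v (ordS i)) (w i) (w (ordS i)) y1 p1 ->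
      is_comparison_point (v j) (v (ordS j)) (w j) (w (ordS j)) y2 p2 ->
      mdist y1 y2 <= edist p1 p2.

Definition N_property (R : realType) (X : metricType R) : Prop :=
  forall S : set X, S !=set0 -> closed S -> geodesically_convex S ->
  forall x1 x2 P : X, metric_proj S x1 = P -> metric_proj S x2 = P ->
  forall a : R, 0 < a < 1 -> metric_proj S (geodesic_comb a x1 x2) = P.

(* Main.v *)
Require Import Defs.
From mathcomp Require Import all_boot all_order all_algebra.
From mathcomp Require Import all_classical all_reals all_analysis.
From mathcomp Require Import ring lra.

Import Order.TTheory GRing.Theory Num.Theory.
Import numFieldNormedType.Exports.

Local Open Scope classical_set_scope.
Local Open Scope ring_scope.

(** Write d for the distance and u = f(q). Everything rests on two inequalities
of CAT(0) spaces: the CN inequality of Bruhat and Tits, with an arbitrary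
weight ([CN_inequality]), and the Cauchy-Schwarz inequality of Berg and
Nikolaev for quadrilaterals ([quadrilateral_inequality]).

Existence of q. The nearest point projection P onto Fix T is 2-Lipschitz
([metric_proj_lipschitz]), so for k < 1/2 the map P o f is a contraction, and q
is its fixed point.

Convergence. The projection onto Fix T has a robust form
([asymptotic_projection]): approximate fixed points x of T satisfy
d(u,q)^2 <= d(u,x)^2 + o(1) as d(x, T x) tends to 0. It replaces the weak limits
and demiclosedness used in the Hilbert space argument. Now put
s_n = d(x_n, q)^2 and a_n = (1 - b_n) (1 - 2k) t_n. For every e > 0,
  s_(n+1) <= (1 - a_n) s_n + a_n e   for all large n,
for one of two reasons. If x_n and y_n are far apart, the negative term
- b_n (1 - b_n) d(x_n, y_n)^2 of the CN inequality outweighs everything of order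
t_n ([viscosity_step_far]). If they are close, then x_n is an approximate fixed
point, so d(u,q)^2 - d(u, T x_n)^2 is at most negligibly positive, and replacing
f(x_n) by u costs at most 2 k s_n, by the quadrilateral inequality; this is absorbed as
2k < 1 ([viscosity_step_near]). As the a_n are not summable, s_n is eventually
at most 2e ([eventually_le_of_recursion]). *)

(** * Two inequalities in CAT(0) spaces *)

Lemma edist_eq (R : realType) (p q : R * R) (r : R) : 0 <= r ->
  (p.1 - q.1) ^+ 2 + (p.2 - q.2) ^+ 2 = r ^+ 2 -> Defs.edist p q = r.
Proof. by move=> r0 e; rewrite /Defs.edist e sqrtr_sqr ger0_norm. Qed.

Lemma sqr_edist (R : realType) (p q : R * R) :
  Defs.edist p q ^+ 2 = (p.1 - q.1) ^+ 2 + (p.2 - q.2) ^+ 2.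
Proof. by rewrite sqr_sqrtr// addr_ge0 ?sqr_ge0. Qed.

(** The third vertex of a triangle with first two vertices (0,0) and (l,0): its
abscissa p is given by the law of cosines, and its height exists because
the triangle inequalities make the squared area nonnegative. *)
Lemma euclidean_triangle (R : realType) (l m n : R) :
  0 <= l -> 0 <= m -> 0 <= n -> l <= m + n -> m <= l + n -> n <= l + m ->
  exists p h, p ^+ 2 + h ^+ 2 = m ^+ 2 /\ (l - p) ^+ 2 + h ^+ 2 = n ^+ 2.
Proof.
move=> l0 m0 n0 lmn mln nlm.
have [l_eq0|l_neq0] := eqVneq l 0.
  exists m, 0; split; first by ring.
  by have -> : n = m by [lra]; rewrite l_eq0; ring.
have lgt0 : 0 < l by rewrite lt_neqAle eq_sym l_neq0.
pose p := (l ^+ 2 + m ^+ 2 - n ^+ 2) / (2 * l).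
have lp : 2 * l * p = l ^+ 2 + m ^+ 2 - n ^+ 2.
  by rewrite /p mulrCA mulfV ?mulr1// mulf_neq0// pnatr_eq0.
have pm : p ^+ 2 <= m ^+ 2.
  (* Heron's factorization of 16 times the squared area *)
  have : (2 * l * p) ^+ 2 <= (2 * l * m) ^+ 2.
    rewrite lp -subr_ge0.
    have -> : (2 * l * m) ^+ 2 - (l ^+ 2 + m ^+ 2 - n ^+ 2) ^+ 2 =
      (l + m + n) * (l + m - n) * ((l + n - m) * (m + n - l)) by ring.
    by rewrite !mulr_ge0// ?subr_ge0 ?addr_ge0// addrC.
  by rewrite !exprMn ler_pM2l// mulr_gt0// exprn_gt0// ltr0n.
exists p, (Num.sqrt (m ^+ 2 - p ^+ 2)).
by rewrite sqr_sqrtr ?subr_ge0//; split; nra.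
Qed.

Section CAT0Inequalities.
Context {R : realType} {X : metricType R}.
Implicit Types (x y z : X) (a : R).

Lemma geodesic_combP a x y : geodesic_space X -> 0 <= a <= 1 ->
  [/\ segment x y (geodesic_comb a x y),
      mdist x (geodesic_comb a x y) = (1 - a) * mdist x y
    & mdist (geodesic_comb a x y) y = a * mdist x y].
Proof.
move=> geo /andP[a0 a1]; rewrite /geodesic_comb.
apply: (@xgetPex _ x [set z | [/\ segment x y z,
  mdist x z = (1 - a) * mdist x y & mdist z y = a * mdist x y]]).
have [c cxy] := geo x y; have [c0 cl dc] := cxy.
have d0 := mdist_ge0 x y.
have s_in : (1 - a) * mdist x y \in `[0, mdist x y].
  by rewrite in_itv/=; apply/andP; split; nra.
have o_in : 0 \in `[0, mdist x y] by rewrite in_itv/= lexx.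
have l_in : mdist x y \in `[0, mdist x y] by rewrite in_itv/= lexx andbT.
exists (c ((1 - a) * mdist x y)); split.
- by exists c => //; exists ((1 - a) * mdist x y).
- by rewrite -[X in mdist X _ = _]c0 dc// sub0r normrN ger0_norm// mulr_ge0// subr_ge0.
- rewrite -[X in mdist _ X = _]cl dc// ler0_norm; first by ring.
  by nra.
Qed.

Definition pick3 {U : Type} (u0 u1 u2 : U) (i : 'I_3) : U :=
  match val i with 0 => u0 | 1 => u1 | _ => u2 end.

(** In the Euclidean plane this is an equality (Stewart's theorem), so it
suffices to compare with the triangle of vertices (0,0), (d(x,y),0) and w2, in
which the combination corresponds to the point m of the first side. *)
Lemma CN_inequality a x y z : CAT0 X -> 0 <= a <= 1 ->
  mdist z (geodesic_comb a x y) ^+ 2 <=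
  a * mdist z x ^+ 2 + (1 - a) * mdist z y ^+ 2 - a * (1 - a) * mdist x y ^+ 2.
Proof.
move=> [geo cat0] a01; have [[c cxy zc] dx dy] := geodesic_combP a x y geo a01.
have /andP[a0 a1] := a01.
have [c1 cyz] := geo y z; have [c2 czx] := geo z x.
have d0 := @mdist_ge0 R X.
have t1 := metric_triangle x z y; rewrite (metric_sym x z) (metric_sym z y) in t1.
have t2 := metric_triangle x y z; rewrite (metric_sym x z) in t2.
have t3 := metric_triangle y x z; rewrite (metric_sym x z) (metric_sym y x) in t3.
have [p [h [ph lph]]] := euclidean_triangle R _ _ _
  (d0 _ _) (d0 _ _) (d0 _ _) t1 t2 t3.
pose w0 : R * R := (0, 0); pose w1 : R * R := (mdist x y, 0); pose w2 : R * R := (p, h).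
pose m : R * R := ((1 - a) * mdist x y, 0).
have cmp : mdist (geodesic_comb a x y) z <= Defs.edist m w2.
  apply: (cat0 (pick3 x y z) (pick3 c c1 c2) (pick3 w0 w1 w2) _ _ ord0
    (@Ordinal 3 1 isT) (geodesic_comb a x y) z m w2).
  - by case=> [[|[|[|//]]] ?].
  - case=> [[|[|[|//]]] ?]; apply: edist_eq; rewrite ?d0//= /pick3/=.
    + by ring.
    + by rewrite -lph; ring.
    + by rewrite -ph; ring.
  - by [].
  (* z is seen as the end point of the side from y to z *)
  - case: cyz => _ cz _; exists (mdist y z) => //=.
    by rewrite in_itv/= lexx d0.
  - split; apply: edist_eq; rewrite ?d0//= ?dx ?dy; first by ring.
    by ring.
  - split; apply: edist_eq; rewrite ?d0//= -?lph ?mdistxx; first by ring.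
    by ring.
have -> : a * mdist z x ^+ 2 + (1 - a) * mdist z y ^+ 2 -
    a * (1 - a) * mdist x y ^+ 2 = Defs.edist m w2 ^+ 2.
  rewrite sqr_edist/= (metric_sym z y) -ph -lph; ring.
by rewrite metric_sym lerXn2r// nnegrE ?d0// sqrtr_ge0.
Qed.

(** With s such that s A = (1 - s) D, where A = d(x1,x2) and D = d(y1,y2), the
points m = s x2 + (1-s) y1 and n = s x1 + (1-s) y2 of the two diagonals satisfy
m - n = s (x2 - x1) - (1-s) (y2 - y1) in a vector space, hence coincide in the
equality case of Cauchy-Schwarz. Expanding 0 <= d(m,n)^2 by the CN inequality
therefore gives the sharp bound. *)
Lemma quadrilateral_inequality x1 x2 y1 y2 : CAT0 X ->
  mdist x1 y2 ^+ 2 + mdist x2 y1 ^+ 2 <=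
  mdist x1 y1 ^+ 2 + mdist x2 y2 ^+ 2 + 2 * mdist x1 x2 * mdist y1 y2.
Proof.
move=> C0; have geo := C0.1; have d0 := @mdist_ge0 R X.
have [->|x12] := eqVneq x1 x2; first by rewrite mdistxx; lra.
have [->|y12] := eqVneq y1 y2; first by rewrite mdistxx; lra.
set A := mdist x1 x2; set D := mdist y1 y2.
have A0 : 0 < A by rewrite mdist_gt0.
have D0 : 0 < D by rewrite mdist_gt0.
have AD0 : 0 < A + D by rewrite addr_gt0.
pose s := D / (A + D).
have sAD : s * (A + D) = D by rewrite mulfVK// gt_eqF.
have s01 : 0 <= s <= 1.
  by apply/andP; split; [rewrite divr_ge0 ?ltW|rewrite ler_pdivrMr// mul1r lerDr ltW].
pose m := geodesic_comb s x2 y1; pose n := geodesic_comb s x1 y2.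
have := CN_inequality s x2 y1 n C0 s01; rewrite -/m.
have := CN_inequality s x1 y2 x2 C0 s01; rewrite -/n.
have := CN_inequality s x1 y2 y1 C0 s01; rewrite -/n.
rewrite (metric_sym x2 x1) (metric_sym y1 x1) (metric_sym n x2) (metric_sym n y1).
rewrite -/A -/D => yn xn mn.
have mn0 := sqr_ge0 (mdist n m).
have /andP[s0 s1] := s01.
set Q := mdist x1 y1 ^+ 2 + mdist x2 y2 ^+ 2
         - mdist x1 y2 ^+ 2 - mdist x2 y1 ^+ 2.
have key : 0 <= s ^+ 2 * A ^+ 2 + (1 - s) ^+ 2 * D ^+ 2 + s * (1 - s) * Q.
  by rewrite /Q; nra.
(* multiply key by (A + D)^2, using s (A + D) = D and (1 - s) (A + D) = A *)
have : 0 <= A * D * (2 * A * D + Q).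
  have -> : A * D * (2 * A * D + Q) =
    (A + D) ^+ 2 * (s ^+ 2 * A ^+ 2 + (1 - s) ^+ 2 * D ^+ 2 + s * (1 - s) * Q).
    have [V eV] : exists V, V = A + D by exists (A + D).
    have eD : D = s * V by rewrite eV sAD.
    have eA : A = (1 - s) * V by rewrite mulrBl -eD eV; ring.
    by rewrite -eV eA [in LHS]eD; ring: eD.
  by rewrite mulr_ge0// sqr_ge0.
by rewrite pmulr_rge0 ?mulr_gt0// /Q; lra.
Qed.

End CAT0Inequalities.

(** * Fixed points and the projection onto the fixed point set *)

Section AsymptoticProjection.
Context {R : realType} {C : completeMetricType R}.
Implicit Types (T G : C -> C) (u p q x z : C).

(** Cantor's intersection theorem for a decreasing family of sets that need
not be closed, whence a conclusion about distances to p instead of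
membership of p. *)
Lemma cantor_intersection (F : R -> set C) :
  (forall d, 0 < d -> F d !=set0) ->
  (forall d d', d <= d' -> F d `<=` F d') ->
  (forall e, 0 < e -> exists2 d, 0 < d &
     forall x x', F d x -> F d x' -> mdist x x' <= e) ->
  exists p, forall e, 0 < e -> exists2 d, 0 < d &
     forall x, F d x -> mdist p x <= e.
Proof.
move=> F0 Fmono Fdiam.
pose FF := filter_from [set d : R | 0 < d] F.
have FF_filter : ProperFilter FF.
  apply: filter_from_proper => //; apply: filter_from_filter; first by exists 1 => /=.
  move=> d d' /= d0 d'0; exists (Num.min d d'); first by rewrite /= lt_min d0.
  by move=> x Fx; split; apply: Fmono Fx; rewrite ge_min lexx ?orbT.
have FF_cauchy : cauchy FF.
  apply: cauchy_exP => e e0.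
  have [d d0 dF] := Fdiam (e / 2) ltac:(by rewrite divr_gt0).
  have [x Fx] := F0 d d0; exists x; exists d => // z Fz.
  rewrite ballEmdist/= (le_lt_trans (dF _ _ Fx Fz))//.
  by rewrite ltr_pdivrMr// ltr_pMr// ltr1n.
have FFl : FF --> lim FF by exact: cauchy_cvg.
exists (lim FF) => e e0; have [d d0 dF] := FFl _ (nbhsx_ballx (lim FF) e e0).
by exists d => // x /dF; rewrite /= ballEmdist => /ltW.
Qed.

(** Banach's theorem: two points almost fixed by a contraction are close to each
other, and the iterates of any point become almost fixed, so Cantor's
intersection theorem applies to the sets of almost fixed points. *)
Lemma contraction_fixed_point c G : is_kcontraction c G -> exists q, G q = q.
Proof.
move=> [/andP[c0 c1] Gc].
pose z n := iter n G (point : C).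
have zc n : mdist (z n) (z n.+1) <= c ^+ n * mdist (z 0%N) (z 1%N).
  elim: n => [|n IH]; first by rewrite expr0 mul1r.
  by rewrite exprS -mulrA (le_trans (Gc _ _))// ler_wpM2l.
have approx d : 0 < d -> exists x, mdist x (G x) <= d.
  move=> d0; have D0 := mdist_ge0 (z 0%N) (z 1%N).
  have : (fun n => c ^+ n * mdist (z 0%N) (z 1%N)) @ \oo
      --> 0 * mdist (z 0%N) (z 1%N).
    by apply: cvgMr_tmp; apply: cvg_expr; rewrite ger0_norm.
  rewrite mul0r => /cvgrPdist_le/(_ d d0)[N _ /(_ N (leqnn N))] /=.
  rewrite sub0r normrN ger0_norm ?mulr_ge0 ?exprn_ge0// => cN.
  by exists (z N); apply: le_trans (zc N) cN.
have [||e e0|q qF] := cantor_intersection (fun d => [set x | mdist x (G x) <= d]).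
- exact: approx.
- by move=> d d' dd' x /= xd; apply: le_trans dd'.
- exists (e * (1 - c) / 2); first by rewrite divr_gt0// mulr_gt0// subr_gt0.
  move=> x x' /= xG x'G.
  have h1 := metric_triangle x (G x) x'; have h2 := metric_triangle (G x) (G x') x'.
  rewrite (metric_sym (G x') x') in h2; have h3 := Gc x x'.
  rewrite -(ler_pM2r (_ : 0 < 1 - c)) ?subr_gt0//; lra.
- exists q; apply/mdist_positivity/eqP; rewrite eq_le mdist_ge0 andbT.
  apply/ler_addgt0Pr => e e0; rewrite add0r.
  have e3 : 0 < e / 3 by rewrite divr_gt0.
  have [d d0 dF] := qF _ e3.
  have [|x] := approx (Num.min d (e / 3)); first by rewrite lt_min d0.
  rewrite le_min => /andP[/dF qx xe].
  have h1 := metric_triangle (G q) (G x) q; have h2 := metric_triangle (G x) x q.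
  have h3 := Gc q x; have := mdist_ge0 q x.
  rewrite (metric_sym (G x) x) (metric_sym x q) in h2 *; nra.
Qed.

Let half01 : 0 <= (1 / 2 : R) <= 1.
Proof. by rewrite divr_ge0 ?ler01//= ler_pdivrMr// mul1r ler1n. Qed.

(** The approximate fixed point sets of T are almost convex: T m lies within
d(x,z)/2 + d of both x and z, and the CN inequality shows that the midpoint m is
the only point at distance d(x,z)/2 from both, in a quantitative way. *)
Lemma midpoint_approx_fix T x z d : CAT0 C -> nonexpansive T ->
  mdist x (T x) <= d -> mdist z (T z) <= d ->
  mdist (geodesic_comb (1 / 2) x z) (T (geodesic_comb (1 / 2) x z)) ^+ 2 <=
  d * (mdist x z + d).
Proof.
move=> C0 Tne xT zT; set m := geodesic_comb _ _ _.
have half := half01.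
have [_ xm mz] := geodesic_combP (1 / 2) x z C0.1 half; rewrite -/m in xm mz.
have := CN_inequality (1 / 2) x z (T m) C0 half; rewrite -/m metric_sym.
have h1 := metric_triangle (T m) (T x) x; have h2 := metric_triangle (T m) (T z) z.
have h3 := Tne m x; have h4 := Tne m z.
rewrite (metric_sym m x) (metric_sym (T x) x) in h1 h3.
rewrite (metric_sym (T z) z) in h2.
have {h1 h3} h1 : mdist (T m) x <= mdist x z / 2 + d by lra.
have {h2 h4} h2 : mdist (T m) z <= mdist x z / 2 + d by lra.
have := mdist_ge0 (T m) x; have := mdist_ge0 (T m) z; nra.
Qed.

(** Let r be the limit, as d tends to 0, of the infimum of d(u,x)^2 over
the d-approximate fixed points x. Almost minimizers are close to each other, as
their midpoint is again an approximate fixed point and would otherwise be too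
close to u by the CN inequality. They accumulate at some p, which is fixed by
T and satisfies d(u,p)^2 <= r. *)
Lemma asymptotic_projection T u : CAT0 C -> nonexpansive T -> Fix T !=set0 ->
  exists2 p, Fix T p & forall e, 0 < e -> exists2 d, 0 < d &
    forall x, mdist x (T x) <= d -> mdist u p ^+ 2 <= mdist u x ^+ 2 + e.
Proof.
move=> C0 Tne [q0 Tq0].
(* the limit r is the least level reached by all approximate fixed point sets *)
pose S := [set r : R | forall d, 0 < d ->
  exists2 x, mdist x (T x) <= d & mdist u x ^+ 2 <= r].
have S0 : S !=set0.
  by exists (mdist u q0 ^+ 2) => d d0; exists q0 => //; rewrite Tq0 mdistxx ltW.
have Slb : lbound S 0.
  by move=> r /(_ 1 ltr01)[x _]; apply: le_trans; rewrite sqr_ge0.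
have Sinf : has_inf S by split => //; exists 0.
pose r := inf S.
have r0 : 0 <= r by apply: lb_le_inf.
have r_low e : 0 < e -> exists2 d, 0 < d &
    forall x, mdist x (T x) <= d -> r < mdist u x ^+ 2 + e.
  move=> e0; apply: contrapT => H.
  suff : r <= r - e by rewrite lerBrDr gerDl leNgt e0.
  apply: ge_inf; first by exists 0.
  move=> d d0; apply: contrapT => H'; apply: H; exists d => // x xd.
  by rewrite -ltrBlDr ltNge; apply/negP => xr; apply: H'; exists x.
have r_up e d : 0 < e -> 0 < d ->
    exists2 x, mdist x (T x) <= d & mdist u x ^+ 2 <= r + e.
  move=> e0 d0; have [s Ss sr] := inf_adherent e0 Sinf.
  by have [x xd xs] := Ss d d0; exists x => //; rewrite (le_trans xs)// ltW.
pose F d := [set x | mdist x (T x) <= d /\ mdist u x ^+ 2 <= r + d].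
have F_bd d x : d <= 1 -> F d x -> mdist u x <= r + 1.
  move=> d1 [_ xr]; rewrite -ler_sqr ?nnegrE ?mdist_ge0 ?addr_ge0//.
  by nra.
have [d d0|d d' dd' x [xd xr]|e e0|p pF] := cantor_intersection F.
- by have [x xd xr] := r_up d d d0 d0; exists x.
- by split; [apply: le_trans dd'|rewrite (le_trans xr)// lerD2l].
- have e8 : 0 < e ^+ 2 / 8 by rewrite divr_gt0// exprn_gt0.
  have [d1 d10 d1r] := r_low _ e8.
  (* B bounds d + d(x,x') in the estimate of d(m, T m)^2 *)
  pose B := 2 * (r + 1) + 1.
  have B0 : 0 < B by rewrite /B; lra.
  exists (Num.min 1 (Num.min (e ^+ 2 / 8) (d1 ^+ 2 / B))).
    by rewrite !lt_min e8 ltr01 divr_gt0// exprn_gt0.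
  set d := Num.min _ _ => x x' Fx Fx'.
  have : d <= Num.min 1 (Num.min (e ^+ 2 / 8) (d1 ^+ 2 / B)) by [].
  rewrite !le_min => /and3P[dle1 de dB].
  have ux := F_bd _ _ dle1 Fx; have ux' := F_bd _ _ dle1 Fx'.
  have [xT xr] := Fx; have [xT' xr'] := Fx'.
  have d_ge0 : 0 <= d by rewrite (le_trans _ xT)// mdist_ge0.
  have xx' : mdist x x' <= 2 * (r + 1).
    have := metric_triangle x u x'; rewrite (metric_sym x u); lra.
  have half := half01.
  have mT := midpoint_approx_fix T x x' d C0 Tne xT xT'.
  have um := CN_inequality (1 / 2) x x' u C0 half.
  set m := geodesic_comb _ _ _ in mT um.
  have /d1r mr : mdist m (T m) <= d1.
    rewrite -ler_sqr ?nnegrE ?mdist_ge0 ?(ltW d10)//.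
    rewrite (le_trans mT)//; rewrite ler_pdivlMr// in dB.
    by rewrite (le_trans _ dB)// ler_wpM2l// /B lerD.
  rewrite -ler_sqr ?nnegrE ?mdist_ge0 ?(ltW e0)//; lra.
have near e : 0 < e -> exists x, [/\ mdist p x <= e, mdist x (T x) <= e,
    mdist u x ^+ 2 <= r + e & mdist u x <= r + 1].
  move=> e0; have [d d0 dF] := pF e e0.
  pose d' := Num.min 1 (Num.min e d).
  have d'0 : 0 < d' by rewrite !lt_min ltr01 e0.
  have [x xT xr] := r_up d' d' d'0 d'0.
  have : d' <= d' by []; rewrite {2}/d' !le_min => /and3P[d'1 d'e d'd].
  exists x; split; last exact: (F_bd _ _ d'1).
  - by apply: dF; split; [exact: le_trans d'd|rewrite (le_trans xr)// lerD2l].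
  - exact: le_trans d'e.
  - by rewrite (le_trans xr)// lerD2l.
have ur : mdist u p ^+ 2 <= r.
  apply/ler_addgt0Pr => e e0.
  pose B := 2 * (r + 1) + 2; have B0 : 0 < B by rewrite /B; lra.
  pose e' := Num.min 1 (e / B).
  have e'0 : 0 < e' by rewrite lt_min ltr01 divr_gt0.
  have [x [px _ xr ux]] := near _ e'0.
  have : e' <= e' by []; rewrite {2}/e' !le_min ler_pdivlMr// => /andP[e'1 e'B].
  have := metric_triangle u x p; rewrite (metric_sym x p) => up.
  have := mdist_ge0 u p; have := mdist_ge0 u x; have := mdist_ge0 p x.
  move=> px0 ux0 up0.
  have : mdist u p ^+ 2 <= (mdist u x + e') ^+ 2.
    rewrite lerXn2r// ?nnegrE ?addr_ge0 ?(ltW e'0)//; lra.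
  rewrite /B in e'B; nra.
exists p.
  apply/esym/mdist_positivity/eqP; rewrite eq_le mdist_ge0 andbT.
  apply/ler_addgt0Pr => e e0; rewrite add0r.
  have e3 : 0 < e / 3 by rewrite divr_gt0.
  have [x [px xT _ _]] := near _ e3.
  have h1 := metric_triangle p x (T p); have h2 := metric_triangle x (T x) (T p).
  have h3 := Tne x p; rewrite (metric_sym x p) in h3; lra.
move=> e e0; have [d d0 dr] := r_low e e0; exists d => // x /dr xr.
by rewrite (le_trans ur)// ltW.
Qed.

(** The point given by [asymptotic_projection] is nearest to u in Fix T, and
any other nearest point is at the same distance from u, so the asymptotic
inequality holds for the chosen one. *)
Lemma metric_projP T u : CAT0 C -> nonexpansive T -> Fix T !=set0 ->
  let p := metric_proj (Fix T) u in
  [/\ Fix T p, (forall z, Fix T z -> mdist u p <= mdist u z) &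
    forall e, 0 < e -> exists2 d, 0 < d &
    forall x, mdist x (T x) <= d -> mdist u p ^+ 2 <= mdist u x ^+ 2 + e].
Proof.
move=> C0 Tne T0 p.
have [p0 Tp0 p0lim] := asymptotic_projection T u C0 Tne T0.
have p0min z : Fix T z -> mdist u p0 <= mdist u z.
  move=> Tz; rewrite -ler_sqr ?nnegrE ?mdist_ge0//.
  apply/ler_addgt0Pr => e e0; have [d d0 dlim] := p0lim e e0.
  by apply: dlim; rewrite Tz mdistxx ltW.
have [Tp pmin] : Fix T p /\ forall z, Fix T z -> mdist u p <= mdist u z.
  by apply: (@xgetPex _ u [set p | Fix T p /\ forall z, Fix T z ->
    mdist u p <= mdist u z]); exists p0.
split=> // e e0; have [d d0 dlim] := p0lim e e0; exists d => // x /dlim.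
by apply: le_trans; rewrite lerXn2r ?nnegrE ?mdist_ge0// pmin.
Qed.

(** Compare u with the midpoint of p and z, which is fixed by T. Convex
combinations closer to p would remove the factor 1/2; the midpoint is enough
for a Lipschitz constant 2 of the projection. *)
Lemma metric_proj_variational T u z : CAT0 C -> nonexpansive T -> Fix T z ->
  mdist u (metric_proj (Fix T) u) ^+ 2
    + mdist (metric_proj (Fix T) u) z ^+ 2 / 2 <= mdist u z ^+ 2.
Proof.
move=> C0 Tne Tz; set p := metric_proj _ _.
have [Tp pmin _] := metric_projP T u C0 Tne (ex_intro _ z Tz).
rewrite -/p in Tp pmin.
have half := half01.
have pm : mdist u p <= mdist u (geodesic_comb (1 / 2) p z).
  apply: pmin; apply/esym/mdist_positivity/eqP.
  rewrite -sqrf_eq0 eq_le sqr_ge0 andbT.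
  have := midpoint_approx_fix T p z 0 C0 Tne.
  by rewrite Tp Tz !mdistxx mul0r; apply.
have := CN_inequality (1 / 2) p z u C0 half.
have := mdist_ge0 u p; nra.
Qed.

(** Add the variational inequalities of the two projections and bound the
difference of the diagonals and the sides by the quadrilateral inequality. *)
Lemma metric_proj_lipschitz T u v : CAT0 C -> nonexpansive T -> Fix T !=set0 ->
  mdist (metric_proj (Fix T) u) (metric_proj (Fix T) v) <= 2 * mdist u v.
Proof.
move=> C0 Tne T0.
have [Tp _ _] := metric_projP T u C0 Tne T0.
have [Tp' _ _] := metric_projP T v C0 Tne T0.
have := metric_proj_variational T u _ C0 Tne Tp'.
have := metric_proj_variational T v _ C0 Tne Tp.
set p := metric_proj _ u; set p' := metric_proj _ v => /= h1 h2.
rewrite (metric_sym p' p) in h1.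
have := quadrilateral_inequality u v p p' C0 => h3.
have [->|pp'] := eqVneq p p'; first by rewrite mdistxx mulr_ge0// mdist_ge0.
rewrite -(ler_pM2r (_ : 0 < mdist p p')) ?mdist_gt0//; lra.
Qed.

End AsymptoticProjection.

(** * Real sequences *)

Section RealSequences.
Context {R : realType}.
Implicit Types (a b s t : nat -> R).

(** The value at 0 is arbitrary, as the sequences of the theorem start at 1. *)
Lemma bounded_range b m M : (forall n, (1 <= n)%N -> m <= b n <= M) ->
  has_lbound (range b) /\ has_ubound (range b).
Proof.
move=> bM; split.
  exists (Num.min m (b 0%N)) => _ [[|n] _ <-]; rewrite ge_min ?lexx ?orbT//.
  by have /andP[->] := bM n.+1 isT.
exists (Num.max M (b 0%N)) => _ [[|n] _ <-]; rewrite le_max ?lexx ?orbT//.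
by have /andP[_ ->] := bM n.+1 isT.
Qed.

Lemma near_gt_limn_inf b c : has_lbound (range b) -> has_ubound (range b) ->
  c < limn_inf b -> \forall n \near \oo, c < b n.
Proof.
move=> lb ub; have := cvg_infs_sup ub lb.
rewrite /limn_inf => /[dup] /cvg_lim -> // infs_cvg c_inf.
have : \forall n \near \oo, c < infs b n by apply: (cvgr_gt _ infs_cvg).
apply: filterS => n /lt_le_trans; apply.
by apply: ge_inf; [exact: has_lbound_sdrop|exists n => /=].
Qed.

Lemma near_lt_limn_sup b c : has_lbound (range b) -> has_ubound (range b) ->
  limn_sup b < c -> \forall n \near \oo, b n < c.
Proof.
move=> lb ub; have := cvg_sups_inf ub lb.
rewrite /limn_sup => /[dup] /cvg_lim -> // sups_cvg c_sup.
have : \forall n \near \oo, sups b n < c by apply: (cvgr_lt _ sups_cvg).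
apply: filterS => n; apply: le_lt_trans.
by apply: ub_le_sup; [exact: has_ubound_sdrop|exists n => /=].
Qed.

Lemma divergent_tail_sums t : (forall n, (1 <= n)%N -> 0 <= t n) ->
  (\sum_(1 <= n <oo) (t n)%:E = +oo)%E ->
  forall N A, (1 <= N)%N -> exists n, A < \sum_(N <= i < n) t i.
Proof.
move=> t0 tdiv N A N1; apply: contrapT => H.
have tN n : \sum_(N <= i < n) t i <= A.
  by rewrite leNgt; apply/negP => An; apply: H; exists n.
suff : (\sum_(1 <= n <oo) (t n)%:E <= (\sum_(1 <= i < N) t i + A)%:E)%E.
  by rewrite tdiv leye_eq.
apply: lime_le.
  by apply: is_cvg_ereal_nneg_natsum_cond => n n1 _; rewrite lee_fin t0.
exists N => // n /= Nn.
by rewrite sumEFin lee_fin (big_cat_nat N1 Nn)/= lerD2l.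
Qed.

(** The interval up to 2e is invariant under the recursion. Above it, each
step decreases s by at least a_n e >= c e t_n, which cannot go on forever
since the t_n are not summable and s is nonnegative. *)
Lemma eventually_le_of_recursion s t a (c e : R) N :
  0 < c -> 0 < e -> (forall n, 0 <= s n) ->
  (forall A, exists n, A < \sum_(N <= i < n) t i) ->
  (forall n, (N <= n)%N -> c * t n <= a n <= 1) ->
  (forall n, (N <= n)%N -> 0 <= a n) ->
  (forall n, (N <= n)%N -> s n.+1 <= (1 - a n) * s n + a n * e) ->
  exists M, forall n, (M <= n)%N -> s n <= 2 * e.
Proof.
move=> c0 e0 s0 tdiv a1 a0 srec.
suff [M NM sM] : exists2 M, (N <= M)%N & s M <= 2 * e.
  exists M; elim=> [|n IH] Mn; first by move: Mn sM; rewrite leqn0 => /eqP ->.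
  move: Mn; rewrite leq_eqVlt => /predU1P[<-//|]; rewrite ltnS => Mn.
  have Nn := leq_trans NM Mn; have sn := IH Mn.
  have := srec n Nn; have /andP[_ an1] := a1 n Nn; have := a0 n Nn; nra.
apply: contrapT => H.
have s_gt n : (N <= n)%N -> 2 * e < s n.
  by move=> Nn; rewrite ltNge; apply/negP => sn; apply: H; exists n.
have s_dec n : (N <= n)%N -> s n + c * e * (\sum_(N <= i < n) t i) <= s N.
  elim: n => [|n IH]; first by rewrite leqn0 => /eqP ->; rewrite big_geq// mulr0 addr0.
  rewrite leq_eqVlt => /predU1P[<-|]; first by rewrite big_geq// mulr0 addr0.
  rewrite ltnS => Nn; rewrite big_nat_recr//= mulrDr.
  have := IH Nn; have := srec n Nn; have := s_gt n Nn.
  have /andP[ctn _] := a1 n Nn; have := a0 n Nn; nra.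
have ce0 : 0 < c * e by rewrite mulr_gt0.
have [n tn] := tdiv (s N / (c * e)).
have Nn : (N <= n)%N.
  rewrite leqNgt; apply/negP => nN; move: tn; rewrite big_geq ?(ltnW nN)//.
  by rewrite ltNge divr_ge0// ltW.
have := s_dec n Nn; rewrite ltr_pdivrMr// mulrC in tn.
by have := s0 n; lra.
Qed.

End RealSequences.

(** * One step of the viscosity iteration *)

Section ViscosityStep.
Context {R : realType} {C : completeMetricType R}.
Context {T f : C -> C} {k K b t : R} {q x y x' : C}.
Context (C_CAT0 : CAT0 C).
Context (T_nonexp : nonexpansive T).
Context (f_contr : is_kcontraction k f).
Context (Tq : T q = q).
Context (b01 : 0 <= b <= 1).
Context (t01 : 0 <= t <= 1).
Context (xK : mdist x q <= K).
Context (fqK : mdist (f q) q <= (1 - k) * K).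
Context (yE : y = geodesic_comb t (f x) (T x)).
Context (x'E : x' = geodesic_comb b x y).

Let Tx_q : mdist (T x) q <= mdist x q.
Proof. by rewrite -{1}Tq. Qed.

Let fx_q : mdist (f x) q <= K.
Proof.
have [/andP[k0 k1] fc] := f_contr.
have : k * mdist x q <= k * K by rewrite ler_wpM2l.
have := metric_triangle (f x) (f q) q; have := fc x q; move: fqK; lra.
Qed.

Let fx_Tx : mdist (f x) (T x) <= 2 * K.
Proof.
have := metric_triangle (f x) q (T x); rewrite (metric_sym q (T x)).
have := fx_q; have := Tx_q; move: xK; lra.
Qed.

Let step_CN : mdist x' q ^+ 2 <= b * mdist x q ^+ 2 + (1 - b) * mdist y q ^+ 2
  - b * (1 - b) * mdist x y ^+ 2.
Proof.
rewrite x'E metric_sym (metric_sym x q) (metric_sym y q).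
exact: CN_inequality.
Qed.

Let y_CN : mdist y q ^+ 2 <= t * mdist (f x) q ^+ 2 + (1 - t) * mdist x q ^+ 2
  - t * (1 - t) * mdist (f x) (T x) ^+ 2.
Proof.
have := CN_inequality t (f x) (T x) q C_CAT0 t01.
rewrite -yE !(metric_sym q) => /le_trans; apply; rewrite lerD2r lerD2l.
have /andP[t0 t1] := t01.
by rewrite ler_wpM2l ?subr_ge0// ler_sqr ?nnegrE ?mdist_ge0.
Qed.

Let y_crude : mdist y q ^+ 2 <= mdist x q ^+ 2 + t * K ^+ 2.
Proof.
have /andP[t0 t1] := t01; apply: (le_trans y_CN).
have h1 : mdist (f x) q ^+ 2 <= K ^+ 2.
  by rewrite ler_sqr ?nnegrE ?mdist_ge0// (le_trans _ xK)// mdist_ge0.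
have := sqr_ge0 (mdist (f x) (T x)); have := sqr_ge0 (mdist x q).
have : 0 <= t * (1 - t) by rewrite mulr_ge0// subr_ge0.
by nra.
Qed.

(** The ball of radius K about q is mapped into itself by T, by f since
(1 - k) K >= d(f(q),q), and it is closed under convex combinations. *)
Lemma viscosity_step_bounded : mdist x' q <= K.
Proof.
have K0 : 0 <= K by rewrite (le_trans _ xK)// mdist_ge0.
have /andP[b0 b1] := b01; have /andP[t0 t1] := t01.
have h1 : mdist (f x) q ^+ 2 <= K ^+ 2 by rewrite ler_sqr ?nnegrE ?mdist_ge0.
have h2 : mdist x q ^+ 2 <= K ^+ 2 by rewrite ler_sqr ?nnegrE ?mdist_ge0.
have h3 : mdist y q ^+ 2 <= K ^+ 2.
  apply: (le_trans y_CN); have : 0 <= t * (1 - t) by rewrite mulr_ge0// subr_ge0.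
  have := sqr_ge0 (mdist (f x) (T x)); nra.
rewrite -ler_sqr ?nnegrE ?mdist_ge0//; apply: (le_trans step_CN).
have : 0 <= b * (1 - b) by rewrite mulr_ge0// subr_ge0.
have := sqr_ge0 (mdist x y); nra.
Qed.

Lemma viscosity_displacement : mdist x (T x) <= mdist x y + 2 * K * t.
Proof.
have [_ _] := geodesic_combP t (f x) (T x) C_CAT0.1 t01; rewrite -yE => yT.
have := metric_triangle x y (T x); rewrite yT.
have /andP[t0 _] := t01; have := fx_Tx; nra.
Qed.

(** As y differs from T x only by order t, d(y,q)^2 exceeds d(x,q)^2 by
at most t K^2, and the required decrease is also at most t K^2. The term
- b (1-b) d(x,y)^2 of the CN inequality pays for both. *)
Lemma viscosity_step_far c :
  c <= b -> 2 * t * K ^+ 2 <= c * mdist x y ^+ 2 -> 0 <= k <= 1 / 2 ->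
  mdist x' q ^+ 2 <= (1 - (1 - b) * (1 - 2 * k) * t) * mdist x q ^+ 2.
Proof.
move=> cb tK /andP[k0 k1]; have /andP[b0 b1] := b01; have /andP[t0 t1] := t01.
have h2 : mdist x q ^+ 2 <= K ^+ 2.
  by rewrite ler_sqr ?nnegrE ?mdist_ge0// (le_trans _ xK)// mdist_ge0.
have s0 := sqr_ge0 (mdist x q).
have h3 : (1 - 2 * k) * t * mdist x q ^+ 2 <= t * K ^+ 2.
  have : t * mdist x q ^+ 2 <= t * K ^+ 2 by rewrite ler_wpM2l.
  have : 0 <= k * t * mdist x q ^+ 2 by rewrite mulr_ge0// mulr_ge0.
  by lra.
have h4 : 2 * t * K ^+ 2 <= b * mdist x y ^+ 2.
  by rewrite (le_trans tK)// ler_wpM2r// sqr_ge0.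
have h5 : mdist y q ^+ 2 - b * mdist x y ^+ 2 <=
    mdist x q ^+ 2 - (1 - 2 * k) * t * mdist x q ^+ 2.
  by have := y_crude; lra.
have : (1 - b) * (mdist y q ^+ 2 - b * mdist x y ^+ 2) <=
    (1 - b) * (mdist x q ^+ 2 - (1 - 2 * k) * t * mdist x q ^+ 2).
  by rewrite ler_wpM2l// subr_ge0.
by have := step_CN; lra.
Qed.

(** By the CN inequality, d(y,q)^2 exceeds (1 - t) d(x,q)^2 by at most
t (d(f x,q)^2 - d(f x,T x)^2) up to order t^2. The quadrilateral inequality
replaces f x by f q here at the cost of 2 d(f x,f q) d(T x,q) <= 2 k d(x,q)^2,
which leaves a contraction factor 1 - (1 - 2k) t. *)
Lemma viscosity_step_near e : k <= 1 / 2 ->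
  mdist (f q) q ^+ 2 <= mdist (f q) (T x) ^+ 2 + (1 - 2 * k) * e / 2 ->
  4 * K ^+ 2 * t <= (1 - 2 * k) * e / 2 ->
  mdist x' q ^+ 2 <= (1 - (1 - b) * (1 - 2 * k) * t) * mdist x q ^+ 2
    + (1 - b) * (1 - 2 * k) * t * e.
Proof.
move=> k1 uq tK; have [/andP[k0 _] fc] := f_contr.
have /andP[b0 b1] := b01; have /andP[t0 t1] := t01.
have quad : mdist (f x) q ^+ 2 - mdist (f x) (T x) ^+ 2 <=
    mdist (f q) q ^+ 2 - mdist (f q) (T x) ^+ 2 + 2 * k * mdist x q ^+ 2.
  have := quadrilateral_inequality (f x) (f q) (T x) q C_CAT0.
  have : mdist (f x) (f q) * mdist (T x) q <= k * mdist x q * mdist x q.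
    by rewrite ler_pM ?mdist_ge0.
  lra.
have d2 : mdist (f x) (T x) ^+ 2 <= 4 * K ^+ 2.
  rewrite (_ : 4 * K ^+ 2 = (2 * K) ^+ 2); last by ring.
  have := fx_Tx => h; rewrite ler_sqr ?nnegrE ?mdist_ge0//.
  by rewrite (le_trans _ h)// mdist_ge0.
have yq : mdist y q ^+ 2 <= (1 - (1 - 2 * k) * t) * mdist x q ^+ 2
    + (1 - 2 * k) * t * e.
  have h : t * (mdist (f x) q ^+ 2 - mdist (f x) (T x) ^+ 2
        + t * mdist (f x) (T x) ^+ 2)
      <= t * (2 * k * mdist x q ^+ 2 + (1 - 2 * k) * e).
    rewrite ler_wpM2l//.
    have : t * mdist (f x) (T x) ^+ 2 <= t * (4 * K ^+ 2) by rewrite ler_wpM2l.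
    lra.
  by have := y_CN; lra.
have h1 : (1 - b) * mdist y q ^+ 2 <= (1 - b) *
    ((1 - (1 - 2 * k) * t) * mdist x q ^+ 2 + (1 - 2 * k) * t * e).
  by rewrite ler_wpM2l// subr_ge0.
have h2 : 0 <= b * (1 - b) * mdist x y ^+ 2.
  by rewrite mulr_ge0 ?sqr_ge0// mulr_ge0// subr_ge0.
by have := step_CN; lra.
Qed.

End ViscosityStep.

(** * Convergence of the viscosity iteration *)

Theorem theorem4p3 (R : realType) (C : completeMetricType R)
    (C_CAT0 : CAT0 C) (C_N : N_property C)
    (T : C -> C) (T_nonexp : nonexpansive T) (FixT_neq0 : Fix T !=set0)
    (f : C -> C) (k : R) (f_contr : is_kcontraction k f) (k_lt : k < 1 / 2) :
  (exists! q : C, Fix T q /\ metric_proj (Fix T) (f q) = q) /\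
  forall q : C, Fix T q -> metric_proj (Fix T) (f q) = q ->
  forall (u : C) (b t : nat -> R),
    (forall n : nat, (1 <= n)%N -> 0 < b n < 1 /\ 0 < t n < 1) ->
    0 < limn_inf b -> limn_inf b <= limn_sup b -> limn_sup b < 1 ->
    t @ \oo --> (0 : R) ->
    (\sum_(1 <= n <oo) (t n)%:E = +oo)%E ->
  forall x y : nat -> C,
    x 1%N = u ->
    (forall n : nat, (1 <= n)%N ->
       y n = geodesic_comb (t n) (f (x n)) (T (x n)) /\
       x n.+1 = geodesic_comb (b n) (x n) (y n)) ->
  x @ \oo --> q.
Proof.
have [/andP[k0 k1] fc] := f_contr.
split.
  pose G x := metric_proj (Fix T) (f x).
  have G_contr : is_kcontraction (2 * k) G.
    split=> [|x z]; first by apply/andP; split; lra.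
    rewrite (le_trans (metric_proj_lipschitz T _ _ C_CAT0 T_nonexp FixT_neq0))//.
    by rewrite -mulrA ler_wpM2l.
  have [q Gq] := contraction_fixed_point _ _ G_contr.
  exists q; split.
    split=> //; rewrite -Gq.
    by have [] := metric_projP T (f q) C_CAT0 T_nonexp FixT_neq0.
  move=> q' [_ Gq']; apply/mdist_positivity/eqP; rewrite eq_le mdist_ge0 andbT.
  have := G_contr.2 q q'; rewrite Gq [G q']Gq'; have := mdist_ge0 q q'; nra.
move=> q Tq Pq u b t bt01 b_inf _ b_sup t_cvg t_div x y _ xy.
have [_ _] := metric_projP T (f q) C_CAT0 T_nonexp FixT_neq0.
rewrite Pq => q_asymp.
have b01 n : (1 <= n)%N -> 0 <= b n <= 1.
  by move=> /bt01[/andP[? ?] _]; rewrite !ltW.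
have t01 n : (1 <= n)%N -> 0 <= t n <= 1.
  by move=> /bt01[_ /andP[? ?]]; rewrite !ltW.
have [b_lb b_ub] := bounded_range b _ _ b01.
pose b0 := limn_inf b / 2; pose b1 := (limn_sup b + 1) / 2.
have b00 : 0 < b0 by rewrite divr_gt0.
have b11 : b1 < 1 by rewrite /b1; lra.
have b0_near : \forall n \near \oo, b0 < b n.
  by apply: near_gt_limn_inf => //; rewrite /b0; lra.
have b1_near : \forall n \near \oo, b n < b1.
  by apply: near_lt_limn_sup => //; rewrite /b1; lra.
(* the whole sequence stays in the ball of radius K about q *)
pose K := Num.max (mdist (x 1%N) q) (mdist (f q) q / (1 - k)).
have fqK : mdist (f q) q <= (1 - k) * K.
  by rewrite mulrC -ler_pdivrMr ?subr_gt0// le_max lexx orbT.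
have xK n : (1 <= n)%N -> mdist (x n) q <= K.
  elim: n => [//|[_ _|n IH _]]; first by rewrite le_max lexx.
  have [yE xE] := xy n.+1 isT.
  exact: (viscosity_step_bounded C_CAT0 T_nonexp f_contr
    Tq (b01 n.+1 isT) (t01 n.+1 isT) (IH isT) fqK yE xE).
pose kap := 1 - 2 * k.
have kap0 : 0 < kap by rewrite /kap; lra.
have K0 : 0 <= K by rewrite le_max mdist_ge0.
apply/metricType_numDomainType.cvgrPdist_le => eps eps0.
(* the recursion bounds the squared distance by 2e = eps^2 *)
pose e := eps ^+ 2 / 2.
have e0 : 0 < e by rewrite divr_gt0// exprn_gt0.
have ke0 : 0 < kap * e / 2 by rewrite divr_gt0// mulr_gt0.
have [d d0 d_asymp] := q_asymp _ ke0.
(* For t <= tau: the first bound makes the term of order t^2 in the near case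
   small; the second turns d(x,y) <= d/2 into d(x, T x) <= d; the third makes
   the CN term dominate as soon as d(x,y) > d/2. *)
pose tau := Num.min (kap * e / 2 / (4 * K ^+ 2 + 1))
  (Num.min (d / 2 / (2 * K + 1)) (b0 * (d / 2) ^+ 2 / (2 * K ^+ 2 + 1))).
have tau0 : 0 < tau.
  have KK0 := sqr_ge0 K.
  by rewrite !lt_min !divr_gt0 ?mulr_gt0 ?exprn_gt0 ?divr_gt0//; lra.
have t_near : \forall n \near \oo, t n <= tau.
  have /cvgrPdist_le/(_ tau tau0) := t_cvg.
  by apply: filterS => n; rewrite sub0r normrN; apply: le_trans (ler_norm _).
have [N _ HN] : \forall n \near \oo, [/\ b0 < b n, b n < b1 & t n <= tau].
  by near=> n; split; near: n.
pose N1 := maxn 1 N.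
have N1_ge1 n : (N1 <= n)%N -> (1 <= n)%N by rewrite geq_max => /andP[].
have [||n|A|n Nn|n Nn|n Nn|M HM] := eventually_le_of_recursion
  (fun n => mdist (x n) q ^+ 2) t (fun n => (1 - b n) * kap * t n)
  ((1 - b1) * kap) e N1.
- by rewrite mulr_gt0// subr_gt0.
- by [].
- exact: sqr_ge0.
- apply: divergent_tail_sums => //; last by rewrite leq_max.
  by move=> n /t01/andP[].
- have [_ bn _] := HN n (leq_trans (leq_maxr _ _) Nn).
  have /andP[bn0 bn1] := b01 n (N1_ge1 n Nn).
  have /andP[tn0 tn1] := t01 n (N1_ge1 n Nn).
  have kt0 : 0 <= kap * t n by rewrite mulr_ge0// ltW.
  have kt1 : kap * t n <= 1 by rewrite mulr_ile1 ?(ltW kap0)// /kap; lra.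
  by rewrite -!mulrA; apply/andP; split; nra.
- have /andP[bn0 bn1] := b01 n (N1_ge1 n Nn).
  have /andP[tn0 tn1] := t01 n (N1_ge1 n Nn).
  by rewrite !mulr_ge0 ?(ltW kap0) ?subr_ge0.
- have [bn _ tn] := HN n (leq_trans (leq_maxr _ _) Nn).
  have n1 := N1_ge1 n Nn.
  have /andP[tn0 _] := t01 n n1; have /andP[_ bn1] := b01 n n1.
  have [yE xE] := xy n n1.
  have KK0 := sqr_ge0 K.
  move: tn; rewrite /tau !le_min !ler_pdivlMr; [|lra..] => /and3P[tn1 tn2 tn3].
  have [xy_small|xy_large] := leP (mdist (x n) (y n)) (d / 2).
    apply: (viscosity_step_near C_CAT0 T_nonexp f_contr
      Tq (b01 _ n1) (t01 _ n1) (xK _ n1) fqK yE xE); first exact: ltW.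
    + apply: d_asymp; apply: le_trans (T_nonexp _ _) _.
      rewrite (le_trans (viscosity_displacement C_CAT0
        T_nonexp f_contr Tq (t01 _ n1) (xK _ n1) fqK yE))//.
      by lra.
    + by move: tn1; rewrite /kap; lra.
  apply: (@le_trans _ _ ((1 - (1 - b n) * kap * t n) * mdist (x n) q ^+ 2)).
    apply: (viscosity_step_far C_CAT0 T_nonexp f_contr
      Tq (b01 _ n1) (t01 _ n1) (xK _ n1) fqK yE xE b0); first exact: ltW.
    + have : b0 * (d / 2) ^+ 2 <= b0 * mdist (x n) (y n) ^+ 2.
        rewrite ler_wpM2l ?(ltW b00)// lerXn2r ?nnegrE ?mdist_ge0 ?(ltW xy_large)//.
        by rewrite ltW// divr_gt0.
      by lra.
    + by rewrite k0 ltW.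
  by rewrite lerDl mulr_ge0 ?(ltW e0)// !mulr_ge0 ?(ltW kap0) ?subr_ge0.
exists M => // n /= /HM xn.
rewrite metric_sym -ler_sqr ?nnegrE ?mdist_ge0 ?(ltW eps0)//.
by move: xn; rewrite /e mulrCA mulfV ?mulr1// pnatr_eq0.
Unshelve. all: by end_near. Qed.
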